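(* Let $\mathcal{A}=\langle A;\Xi\rangle$ be an algebra. 1) If $f:A\to A$ is congruence preserving then $f^{-1}(L)\in\mathcal{B}_{\mathcal{A}}(L)$ for every $\mathcal{A}$-recognizable $L\subseteq A$. 2) Assume $\mathcal{A}$ is c-residually finite. If $f:A\to A$ is such that $f^{-1}(L)\in\mathcal{B}_{\mathcal{A}}(L)$ for every $\mathcal{A}$-recognizable $L\subseteq A$, then $f$ is congruence preserving.
   Context: A congruence is an equivalence relation $\sim$ on $A$ with $x_i\sim y_i$ for all $i$ implying $\xi(\vec x)\sim\xi(\vec y)$ for every operation $\xi\in\Xi$; $f$ is congruence preserving if $x\sim y\Rightarrow f(x)\sim f(y)$ for all congruences. $\mathcal{A}$ is c-residually finite if every congruence is an intersection of congruences with finitely many classes. Frozen functions: $x\mapsto\xi(c_1,\ldots,c_{i-1},x,c_{i+1},\ldots,c_m)$ for $\xi\in\Xi$ of arity $m\ge1$, constants $c_j$; $\mathrm{DUO}(\mathcal{A})$: identity and all finite compositions of frozen functions. $L$ is $\mathcal{A}$-recognizable if $L=\varphi^{-1}(\varphi(L))$ for some surjective morphism $\varphi$ onto a finite algebra of the same signature. $\mathcal{B}_{\mathcal{A}}(L)$: smallest family of subsets of $A$ containing $L$, closed under binary union, binary intersection, complementation and $\gamma^{-1}$ for all $\gamma\in\mathrm{DUO}(\mathcal{A})$. *)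

(* Defs.v *)
From mathcomp Require Import all_boot.
From mathcomp Require Import boolp classical_sets functions cardinality.
From Corelib Require Import RelationClasses.

Set Implicit Arguments.
Unset Strict Implicit.
Unset Printing Implicit Defensive.

Local Open Scope classical_set_scope.

Record signature : Type := Signature {
  symbol : Type;
  arity : symbol -> nat }.

Record algebra (S : signature) : Type := Algebra {
  carrier :> Type;
  op : forall s : symbol S, ('I_(arity s) -> carrier) -> carrier }.

Definition congruence (S : signature) (A : algebra S)
    (r : A -> A -> Prop) : Prop :=
  Equivalence r /\
  forall (s : symbol S) (x y : 'I_(arity s) -> A),
    (forall i, r (x i) (y i)) -> r (op x) (op y).

Definition congruence_preserving (S : signature) (A : algebra S)
    (f : A -> A) : Prop :=
  forall r : A -> A -> Prop, congruence r ->
  forall x y : A, r x y -> r (f x) (f y).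

(* [r x], as a subset of [A], is the class of [x]. *)
Definition finite_index (A : Type) (r : A -> A -> Prop) : Prop :=
  finite_set [set r x | x in [set: A]].

Definition c_residually_finite (S : signature) (A : algebra S) : Prop :=
  forall r : A -> A -> Prop, congruence r ->
  exists2 F : set (A -> A -> Prop),
    (forall t, F t -> congruence t /\ finite_index t) &
    forall x y : A, r x y <-> (forall t, F t -> t x y).

(* The value [c i] is irrelevant: [dfwith c x] overrides it with [x : A] in
   position [i].  The existence of [i : 'I_(arity s)] forces arity >= 1. *)
Definition frozen (S : signature) (A : algebra S) : set (A -> A) :=
  [set g | exists (s : symbol S) (i : 'I_(arity s)) (c : 'I_(arity s) -> A),
    g = fun x : A => op (dfwith c (i := i) x)].

Inductive DUO (S : signature) (A : algebra S) : set (A -> A) :=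
| DUO_id : DUO id
| DUO_comp (g h : A -> A) : @frozen S A g -> DUO h -> DUO (g \o h).

Definition morphism (S : signature) (A B : algebra S) (phi : A -> B) : Prop :=
  forall (s : symbol S) (x : 'I_(arity s) -> A), phi (op x) = op (phi \o x).

Definition recognizable (S : signature) (A : algebra S) (L : set A) : Prop :=
  exists (B : algebra S) (phi : A -> B),
    [/\ finite_set [set: B], morphism phi, set_surj [set: A] [set: B] phi &
        L = phi @^-1` (phi @` L)].

Definition DUO_closed (S : signature) (A : algebra S)
    (F : set (set A)) : Prop :=
  [/\ forall X Y, F X -> F Y -> F (X `|` Y),
      forall X Y, F X -> F Y -> F (X `&` Y),
      forall X, F X -> F (~` X) &
      forall (g : A -> A) X, @DUO S A g -> F X -> F (g @^-1` X)].

Definition boolean_DUO (S : signature) (A : algebra S) (L : set A) :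
    set (set A) :=
  smallest (@DUO_closed S A) [set L].

(* Main.v *)
(** A congruence saturating [L] saturates every member of the lattice
    [boolean_DUO L].

    1) The syntactic relation of [L] (no [g^-1(L)] with [g] in DUO separates [x]
    from [y]) is a congruence, so a congruence preserving [f] preserves it.
    Hence any two points separated by [f^-1(L)] are separated by a member of
    [boolean_DUO L].  As [L] is a union of classes of a congruence with finitely
    many classes, finitely many such separators suffice, and [f^-1(L)] is a
    finite union of finite intersections of them.

    2) A class [L] of a finite index congruence [t] is recognizable through the
    quotient algebra, so [f^-1(L)] is saturated by [t]; with [L] the class of
    [f x] this says that [t x y] implies [t (f x) (f y)].  C-residual finiteness
    extends this from finite index congruences to all of them. *)

Require Import Defs.
From mathcomp Require Import all_boot.
From mathcomp Require Import boolp classical_sets functions cardinality.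
From Corelib Require Import RelationClasses.

Local Open Scope classical_set_scope.

Definition saturated {T : Type} (r : T -> T -> Prop) (X : set T) : Prop :=
  forall x y, r x y -> X x -> X y.

Lemma bigcap_closed {T : Type} (F : set (set T)) :
  F setT -> (forall X Y, F X -> F Y -> F (X `&` Y)) ->
  forall G, finite_set G -> G `<=` F -> F (\bigcap_(X in G) X).
Proof.
move=> FT FI G Gfin GF; rewrite -(bigsetI_fset_set _ Gfin) big_seq.
by elim/big_rec: _ => // X Y; rewrite in_fset_set// inE => /GF; exact: FI.
Qed.

Lemma bigcup_closed {T : Type} (F : set (set T)) :
  F set0 -> (forall X Y, F X -> F Y -> F (X `|` Y)) ->
  forall G, finite_set G -> G `<=` F -> F (\bigcup_(X in G) X).
Proof.
move=> F0 FU G Gfin GF; rewrite -(bigsetU_fset_set _ Gfin) big_seq.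
by elim/big_rec: _ => // X Y; rewrite in_fset_set// inE => /GF; exact: FU.
Qed.

Section separation.
Variables (T I : Type) (phi : T -> I) (F : set (set T)).
Hypotheses (Ifin : finite_set [set: I]) (phi_surj : forall i, exists x, phi x = i).
Hypotheses (F0 : F set0) (FT : F setT).
Hypothesis FU : forall X Y, F X -> F Y -> F (X `|` Y).
Hypothesis FI : forall X Y, F X -> F Y -> F (X `&` Y).
Let kernel x y := phi x = phi y.
Hypothesis F_saturated : forall X, F X -> saturated kernel X.

(** Saturation reduces everything to one representative per class of [phi]. There are finitely many
    pairs of classes, so one separator per pair is enough to write [M] as a finite union of finite
    intersections. *)
Lemma separated_mem {M : set T} : saturated kernel M ->
  (forall x y, M x -> ~ M y -> exists2 X, F X & X x /\ ~ X y) -> F M.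
Proof.
move=> Msat sepM; have [rep repK] := choice phi_surj.
have sepP (p : I * I) : exists X, F X /\
    (M (rep p.1) -> ~ M (rep p.2) -> X (rep p.1) /\ ~ X (rep p.2)).
  case: p => i j /=.
  (* [setT] is a default value for the pairs that need no separation. *)
  have [Mi|nMi] := pselect (M (rep i)); last by exists setT.
  have [Mj|nMj] := pselect (M (rep j)); first by exists setT.
  by have [X FX sepX] := sepM _ _ Mi nMj; exists X.
have [U UP] := choice sepP.
(* For a class [i] inside [M], [V i] contains that class and misses every class outside [M]. *)
pose V i := \bigcap_(X in [set U (i, j) | j in ~` (M \o rep)]) X.
have FV i : F (V i).
  apply: bigcap_closed => //; first exact/finite_image/(sub_finite_set _ Ifin).
  by move=> _ [j _ <-]; have [] := UP (i, j).
suff -> : M = \bigcup_(X in [set V i | i in M \o rep]) X.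
  apply: bigcup_closed => //; first exact/finite_image/(sub_finite_set _ Ifin).
  by move=> _ [i _ <-].
have repP x : kernel x (rep (phi x)) by rewrite /kernel repK.
have repP' x : kernel (rep (phi x)) x by rewrite /kernel repK.
apply/seteqP; split=> [x Mx|x [_ [i /= Mi <-] Vix]].
  have Mrx : M (rep (phi x)) by exact: Msat (repP x) Mx.
  exists (V (phi x)); first by exists (phi x).
  apply: (F_saturated _ (FV _)) (repP' x) _ => _ [j nMj <-].
  by have [_ /(_ Mrx nMj)[]] := UP (phi x, j).
apply: contrapT => nMx.
have nMrx : ~ M (rep (phi x)) by move=> /(Msat _ _ (repP' x)).
have [FUi /(_ Mi nMrx)[_ nU]] := UP (i, phi x).
apply: nU; apply: (F_saturated _ FUi _ _ (repP x)); apply: Vix.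
by exists (phi x).
Qed.

End separation.

Section congruences.
Context {S : signature} {A : algebra S}.
Implicit Types (r : A -> A -> Prop) (L X : set A).

(** [DUO_comp] adds frozen functions on the left only; the syntactic congruence needs one added on
    the right. *)
Lemma DUO_composition {g h : A -> A} : DUO g -> DUO h -> DUO (g \o h).
Proof. by move=> Dg Dh; elim: Dg => // u v Fu _ IH; exact: (DUO_comp Fu IH). Qed.

Lemma frozen_DUO {g : A -> A} : frozen g -> DUO g.
Proof. by move=> Fg; exact: (DUO_comp Fg (DUO_id A)). Qed.

(** The arguments are changed one at a time, and transitivity chains the steps: [z k] takes its
    first [k] entries from [y] and the others from [x]. *)
Lemma frozen_congruence {r} : Equivalence r ->
  (forall g, frozen g -> forall x y, r x y -> r (g x) (g y)) -> congruence r.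
Proof.
move=> eqr rfrozen; split=> // s x y rxy.
pose z k (i : 'I_(arity s)) := if (i < k)%N then y i else x i.
have z0 : z 0 = x by [].
have zn : z (arity s) = y by apply/funext => i; rewrite /z ltn_ord.
suff rz k : (k <= arity s)%N -> r (op x) (op (z k)) by rewrite -zn; exact: rz.
elim: k => [_|k IH lt_kn]; first by rewrite z0; reflexivity.
transitivity (op (z k)); first exact/IH/ltnW.
pose i := Ordinal lt_kn.
(* [z k] and [z k.+1] differ only at position [k], so [op] takes on them the values of a single
   frozen function at [x i] and [y i]. *)
have zx : z k = @dfwith _ (fun=> carrier A) (z k) i (x i).
  apply: funext => j; case: dfwithP => //.
  by rewrite /z ltnn.
have zy : z k.+1 = @dfwith _ (fun=> carrier A) (z k) i (y i).
  apply: funext => j; case: dfwithP => [|j']; first by rewrite /z ltnSn.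
  by rewrite -val_eqE /z ltnS leq_eqVlt eq_sym /= => /negPf->.
rewrite zy [in op (z k)]zx.
by apply: (rfrozen (fun a => op (dfwith (z k) a))) (rxy i); exists s, i, (z k).
Qed.

Lemma congruence_frozen {r} {g : A -> A} : congruence r -> frozen g ->
  forall x y, r x y -> r (g x) (g y).
Proof.
move=> [eqr rop] [s [i [c ->]]] x y rxy; apply: rop => j.
have [<-|ij] := eqVneq i j; first by rewrite !dfwith_in.
by rewrite !dfwith_out//; reflexivity.
Qed.

Lemma congruence_DUO {r} {g : A -> A} : congruence r -> DUO g ->
  forall x y, r x y -> r (g x) (g y).
Proof.
move=> cr; elim=> // u v Fu _ IH x y /IH; exact: (congruence_frozen cr Fu).
Qed.

Lemma boolean_DUO_self L : boolean_DUO L L.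
Proof. by move=> F [_]; apply. Qed.

Lemma boolean_DUO_closed L : DUO_closed (boolean_DUO L).
Proof.
split=> [X Y BX BY|X Y BX BY|X BX|g X Dg BX] F FP;
  have [[FU FI FC Fg] _] := FP.
- by apply: FU; [exact: BX | exact: BY].
- by apply: FI; [exact: BX | exact: BY].
- by apply: FC; exact: BX.
- by apply: Fg => //; exact: BX.
Qed.

(** The sets saturated by [r] form a [DUO_closed] family; complements use the symmetry of [r]. *)
Lemma boolean_DUO_saturated {r L X} : congruence r -> saturated r L ->
  boolean_DUO L X -> saturated r X.
Proof.
move=> cr Lsat BX; apply: (BX (saturated r)); split=> [|_ ->]//.
have [eqr _] := cr.
split=> [Y Z Ys Zs x y rxy [/(Ys _ _ rxy)|/(Zs _ _ rxy)]
        |Y Z Ys Zs x y rxy [/(Ys _ _ rxy)Yy /(Zs _ _ rxy)]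
        |Y Ys x y rxy nYx Yy
        |g Y Dg Ys x y rxy].
- by left.
- by right.
- by [].
- by apply/nYx/Ys/Yy; symmetry.
- exact: (Ys _ _ (congruence_DUO cr Dg _ _ rxy)).
Qed.

Definition syntactic L (x y : A) : Prop :=
  forall g, DUO g -> (L (g x) <-> L (g y)).

Lemma syntactic_congruence L : congruence (syntactic L).
Proof.
apply: frozen_congruence => [|g Fg x y xy h Dh]; last first.
  exact: (xy _ (DUO_composition Dh (frozen_DUO Fg))).
split=> [x g|x y xy g Dg|x y z xy yz g Dg]//; first by have [] := xy g Dg.
by have [? ?] := xy g Dg; have [? ?] := yz g Dg; split; auto.
Qed.

Lemma kernel_congruence {B : algebra S} {phi : A -> B} :
  morphism phi -> congruence (fun x y => phi x = phi y).
Proof.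
move=> phiM; split=> [|s x y xy]; first by split=> // x y z ->.
by rewrite !phiM; congr op; apply/funext => i; exact: xy.
Qed.

Section quotient.
Context {r : A -> A -> Prop}.
Hypothesis cr : congruence r.

(** The quotient consists of the classes as subsets of [A], so finite index is literally finiteness
    of its carrier. *)
Let class (a : A) : range r := exist _ (r a) (mem_set (imageT r a)).

Let classP a b : class a = class b <-> r a b.
Proof.
have [eqr _] := cr; split=> [[->]|rab]; first by reflexivity.
apply: val_inj => /=; apply/funext => c; apply/propext.
by split=> [rac|rbc]; [transitivity a; first symmetry | transitivity b].
Qed.

Let class_surj (X : range r) : exists a, class a = X.
Proof. by have [a _ aX] := set_mem (valP X); exists a; exact: val_inj. Qed.

Lemma saturated_recognizable {L} :
  finite_index r -> saturated r L -> recognizable L.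
Proof.
move=> rfin Lsat; have [rep repK] := choice class_surj.
(* Operations are computed on chosen representatives; compatibility of [r] makes [class] a
   morphism. *)
pose B := @Algebra S (range r) (fun s (X : _ -> range r) => class (@op S A s (rep \o X))).
exists B, class; split.
- by rewrite (eq_finite_set (card_setT (range r))).
- move=> s x; apply/classP; apply: cr.2 => i /=.
  by apply/classP; rewrite repK.
- by move=> X _; have [a aX] := class_surj X; exists a.
- apply/seteqP; split=> [x Lx|x [y Ly /classP ryx]]; first by exists x.
  exact: Lsat ryx Ly.
Qed.

End quotient.

Lemma congruence_preserving_preimage {f : A -> A} {L} :
  congruence_preserving f -> recognizable L -> boolean_DUO L (f @^-1` L).
Proof.
move=> fcp [B [phi [Bfin phiM phi_surj LE]]].
have cker := kernel_congruence phiM.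
have Lsat : saturated (fun x y => phi x = phi y) L.
  by move=> x y xy Lx; rewrite LE; exists x.
have [BU BI BC Bg] := boolean_DUO_closed L.
have BL := @boolean_DUO_self L.
apply: (@separated_mem _ _ phi (boolean_DUO L)) => //.
- by move=> b; have [x _ <-] := phi_surj b I; exists x.
- by rewrite -(setICr L); exact: (BI _ _ BL (BC _ BL)).
- by rewrite -(setUv L); exact: (BU _ _ BL (BC _ BL)).
- by move=> X BX; exact: (boolean_DUO_saturated cker Lsat BX).
- by move=> x y xy; exact: (Lsat _ _ (fcp _ cker _ _ xy)).
move=> x y Lfx nLfy; apply: contrapT => nsep; apply: nLfy.
suff xy : syntactic L x y.
  by have [/(_ Lfx)] := fcp _ (syntactic_congruence L) _ _ xy id (DUO_id A).
move=> g Dg; split=> Lg; apply: contrapT => nLg; apply: nsep.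
  by exists (g @^-1` L); [exact: (Bg _ _ Dg BL) | split].
by exists (~` (g @^-1` L)); [exact: (BC _ (Bg _ _ Dg BL)) | split=> //; apply].
Qed.

Lemma preimage_finite_index {f : A -> A} {r} :
  (forall L, recognizable L -> boolean_DUO L (f @^-1` L)) ->
  congruence r -> finite_index r -> forall x y, r x y -> r (f x) (f y).
Proof.
move=> fB cr rfin x y rxy; have [eqr _] := cr.
have Lsat : saturated r (r (f x)) by move=> a b rab rfa; transitivity a.
have BL := fB _ (saturated_recognizable cr rfin Lsat).
apply: (boolean_DUO_saturated cr Lsat BL _ _ rxy) => /=; reflexivity.
Qed.

End congruences.

Theorem theorem4p13 (S : signature) (A : algebra S) :
  (forall f : A -> A, congruence_preserving f ->
    forall L : set A, recognizable L -> boolean_DUO L (f @^-1` L)) /\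
  (c_residually_finite A ->
    forall f : A -> A,
      (forall L : set A, recognizable L -> boolean_DUO L (f @^-1` L)) ->
      congruence_preserving f).
Proof.
split=> [f fcp L Lrec|Arf f fB r cr x y].
  exact: (congruence_preserving_preimage fcp Lrec).
have [F Fcong rE] := Arf r cr.
rewrite !rE => xy t Ft; have [ct tfin] := Fcong t Ft.
exact: (preimage_finite_index fB ct tfin _ _ (xy t Ft)).
Qed.
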